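(* Let $N\ge2$, $h=1/N$, $\eta\ge0$, and consider the generalized matrix eigenvalue problem of $C^2$-cubic softIGA with $N$ uniform elements on $[0,1]$, $$(\tilde K_3-\eta S_3)\hat U=\hat\lambda^h\tilde M_3\hat U,$$ with $\tilde K_3,\tilde M_3,S_3\in\mathbb R^{(N-1)\times(N-1)}$ as in the context. Its eigenpairs are $(\hat\lambda^h_j,\hat U_j)$, $j\in\{1,\dots,N-1\}$, where, with $t_j:=j\pi h$ and some normalization constants $c_j>0$, $$\hat\lambda^h_j=\frac{168\sin^2(\frac{t_j}2)}{h^2}\cdot\frac{33-1200\eta+2(13+900\eta)\cos(t_j)+(1-720\eta)\cos(2t_j)+120\eta\cos(3t_j)}{1208+1191\cos(t_j)+120\cos(2t_j)+\cos(3t_j)},$$ $$\hat U_j=c_j\big(\sin(kt_j)\big)_{k\in\{1,\dots,N-1\}}.$$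
   Context: $\tilde K_3,\tilde M_3,S_3$ are the matrices, in the (boundary-modified) B-spline basis of the space of $C^2$ piecewise cubics $w$ on the uniform mesh of $[0,1]$ with $w=w''=0$ at $0$ and $1$, of the bilinear forms $\int_0^1v'w'\,dx$, $\int_0^1 vw\,dx$, and $h^{5}\sum_{\text{interior nodes}}[\![v''']\!][\![w''']\!]$. Explicitly, they are symmetric and persymmetric $(N-1)\times(N-1)$ Toeplitz-plus-Hankel matrices $$A_{kl}=\sum_{m\in\mathbb Z}\big(a_{|k-l+2Nm|}-a_{|k+l+2Nm|}\big),\qquad 1\le k,l\le N-1,$$ with stencils (entries not listed are $0$): $\tilde K_3$: $(a_0,\dots,a_3)=\frac1h(\frac23,-\frac18,-\frac15,-\frac1{120})$; $\tilde M_3$: $(a_0,\dots,a_3)=h(\frac{151}{315},\frac{397}{1680},\frac1{42},\frac1{5040})$; $S_3$: $(a_0,\dots,a_4)=\frac1h(70,-56,28,-8,1)$. For instance, for large $N$ the first row of $S_3$ is $\frac1h(42,-48,27,-8,1,0,\dots)$. *)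

(* Defs.v *)
From mathcomp Require Import all_boot all_order all_algebra.
From mathcomp Require Import all_classical all_reals all_analysis.

Set Implicit Arguments.
Unset Strict Implicit.
Unset Printing Implicit Defensive.

Import Order.TTheory GRing.Theory Num.Theory.

Local Open Scope classical_set_scope.
Local Open Scope ring_scope.

(* Row/column i : 'I_N.-1 stands for the 1-based index i + 1 in {1, ..., N-1}.
   For N > 0 and a stencil a with bounded support, the sum over the integers
   has only finitely many nonzero terms. *)
Definition stencil_mx (R : realType) (N : nat) (a : nat -> R) : 'M[R]_(N.-1) :=
  \matrix_(k < N.-1, l < N.-1)
    \sum_(m \in [set: int])
      (a `|(k.+1%:Z - l.+1%:Z + 2 * N%:Z * m)%R|%N
       - a `|(k.+1%:Z + l.+1%:Z + 2 * N%:Z * m)%R|%N).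

Definition mesh_size (R : realType) (N : nat) : R := 1 / N%:R.

Definition stiffness_stencil (R : realType) (N i : nat) : R :=
  (mesh_size R N)^-1 * [:: 2 / 3; - (1 / 8); - (1 / 5); - (1 / 120)]`_i.

Definition mass_stencil (R : realType) (N i : nat) : R :=
  mesh_size R N * [:: 151 / 315; 397 / 1680; 1 / 42; 1 / 5040]`_i.

Definition softness_stencil (R : realType) (N i : nat) : R :=
  (mesh_size R N)^-1 * [:: 70; - 56; 28; - 8; 1]`_i.

Definition stiffness_mx (R : realType) (N : nat) : 'M[R]_(N.-1) :=
  stencil_mx N (stiffness_stencil R N).

Definition mass_mx (R : realType) (N : nat) : 'M[R]_(N.-1) :=
  stencil_mx N (mass_stencil R N).

Definition softness_mx (R : realType) (N : nat) : 'M[R]_(N.-1) :=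
  stencil_mx N (softness_stencil R N).

Definition gen_eigenpair (R : realType) (n : nat) (A B : 'M[R]_n)
    (lambda : R) (U : 'cV[R]_n) : Prop :=
  U != 0 /\ A *m U = lambda *: (B *m U).

(* From here on j is the 1-based index, 1 <= j <= N-1. *)
Definition node_angle (R : realType) (N j : nat) : R :=
  j%:R * pi * mesh_size R N.

Definition softiga_eigval (R : realType) (N : nat) (eta : R) (j : nat) : R :=
  let t := node_angle R N j in
  168 * sin (t / 2) ^+ 2 / mesh_size R N ^+ 2 *
  ((33 - 1200 * eta + 2 * (13 + 900 * eta) * cos t
      + (1 - 720 * eta) * cos (2 * t) + 120 * eta * cos (3 * t))
   / (1208 + 1191 * cos t + 120 * cos (2 * t) + cos (3 * t))).

Definition sine_vec (R : realType) (N j : nat) : 'cV[R]_(N.-1) :=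
  \col_(k < N.-1) sin (k.+1%:R * node_angle R N j).

(* Main.v *)
(* Extend [sin (l t_j)] to all integers [l]: it is odd and 2N-periodic.  Unfolding
   the Toeplitz-plus-Hankel sum along the orbits of [l |-> - l] and
   [l |-> l + 2N] turns the action of a stencil matrix on the sine vector into a
   convolution with [a `|d|] over the whole of Z, so the sine vector is an
   eigenvector with eigenvalue the symbol [a_0 + 2 sum_i a_i cos (i t_j)].  Hence
   the sine vectors diagonalize all three matrices at once, and the generalized
   eigenvalues are quotients of symbols, the mass symbol being positive. *)

Require Import Defs.
From mathcomp Require Import all_boot all_order all_algebra.
From mathcomp Require Import all_classical all_reals all_analysis.
From mathcomp Require Import zify ring lra.

Set Implicit Arguments.
Unset Strict Implicit.
Unset Printing Implicit Defensive.

Import Order.TTheory GRing.Theory Num.Theory.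

Local Open Scope ring_scope.

(** * Stencils as convolutions over the integers *)

(** Since [M] is nonzero, the progression [c + M * m] meets [d] at most once, and does so exactly
    when [M] divides [d - c]; the last hypothesis keeps that index inside [r]. *)
Lemma sum_indic_progression (R : pzRingType) (r : seq int) (M c d : int) :
  M != 0 -> uniq r -> (forall m, d = c + M * m -> m \in r) ->
  \sum_(m <- r) (d == c + M * m)%:R = (M %| d - c)%Z%:R :> R.
Proof.
move=> M0 ur Hr.
have [/dvdzP[q dq]|ndiv] := boolP (M %| d - c)%Z; last first.
  rewrite big1 // => m _; case: eqP => // dE.
  by case/negP: ndiv; rewrite dE addrC addKr dvdz_mulr.
have dE : d = c + M * q by rewrite mulrC -dq addrC subrK.
rewrite (bigD1_seq q) ?Hr //= -dE eqxx big1 ?addr0 // => m mq.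
by rewrite dE (inj_eq (addrI c)) (inj_eq (mulfI M0)) eq_sym (negPf mq).
Qed.

(* The sum of [a `|d| * f d] over the integers [d], for [a] supported in [0, p]. *)
Definition stencil_pairing (R : pzRingType) (p : nat) (a : nat -> R)
    (f : int -> R) : R :=
  a 0%N * f 0 + \sum_(i < p) a i.+1 * (f i.+1%:Z + f (- i.+1%:Z)).

(** Writes a stencil entry as a pairing, which is linear in its function argument, so that the sums
    over [m] and over the columns can be moved inside it. *)
Lemma stencil_pairing_indic (R : pzRingType) (p : nat) (a : nat -> R) (n : int) :
  (forall i, (p < i)%N -> a i = 0) ->
  stencil_pairing p a (fun d => (d == n)%:R) = a `|n|%N.
Proof.
move=> a0; rewrite /stencil_pairing; case: n => [[|n]|n].
- by rewrite ?eqxx mulr1 big1 ?addr0 // => i _; rewrite !(mulr0, addr0).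
- rewrite (_ : (0 == _) = false) ?mulr0 ?add0r; last by lia.
  rewrite (eq_bigr (fun i : 'I_p => if i == n :> nat then a i.+1 else 0)).
    rewrite -big_mkcond (big_ord1_eq _ (fun i => a i.+1)).
    by case: ltnP => // ?; rewrite a0 //; lia.
  move=> i _; rewrite (_ : (- i.+1%:Z == n.+1) = false) ?addr0; last by lia.
  by rewrite eqz_nat eqSS; case: eqP; rewrite ?mulr1 ?mulr0.
- rewrite (_ : (0 == _) = false) ?mulr0 ?add0r; last by lia.
  rewrite (eq_bigr (fun i : 'I_p => if i == n :> nat then a i.+1 else 0)).
    rewrite -big_mkcond (big_ord1_eq _ (fun i => a i.+1)).
    by case: ltnP => // ?; rewrite a0 //; lia.
  move=> i _; rewrite (_ : (i.+1%:Z == Negz n) = false) ?add0r; last by lia.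
  rewrite (_ : (- i.+1%:Z == Negz n) = (i == n :> nat)); last by lia.
  by case: eqP; rewrite ?mulr1 ?mulr0.
Qed.

Lemma stencil_pairing_sum (R : pzRingType) (p : nat) (a : nat -> R)
    (I : Type) (r : seq I) (f : I -> int -> R) :
  \sum_(m <- r) stencil_pairing p a (f m) =
  stencil_pairing p a (fun d => \sum_(m <- r) f m d).
Proof.
rewrite /stencil_pairing big_split /= -mulr_sumr exchange_big /=.
by congr (_ + _); apply: eq_bigr => i _; rewrite -big_split /= mulr_sumr.
Qed.

Lemma eq_stencil_pairing (R : pzRingType) (p : nat) (a : nat -> R)
    (f g : int -> R) :
  (forall d : int, (`|d| <= p)%N -> f d = g d) ->
  stencil_pairing p a f = stencil_pairing p a g.
Proof.
move=> fg; rewrite /stencil_pairing fg //; congr (_ + _).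
by apply: eq_bigr => i _; have ip := ltn_ord i; rewrite !fg //; lia.
Qed.

Lemma stencil_pairingB (R : pzRingType) (p : nat) (a : nat -> R)
    (f g : int -> R) :
  stencil_pairing p a (fun d => f d - g d) =
  stencil_pairing p a f - stencil_pairing p a g.
Proof.
rewrite /stencil_pairing mulrBr opprD addrACA -sumrB; congr (_ + _).
by apply: eq_bigr => i _; rewrite -mulrBr opprD addrACA.
Qed.

Lemma stencil_pairing_mulr (R : comPzRingType) (p : nat) (a : nat -> R)
    (f : int -> R) (x : R) :
  stencil_pairing p a f * x = stencil_pairing p a (fun d => x * f d).
Proof.
rewrite /stencil_pairing mulrDl mulr_suml; congr (_ + _); first by ring.
by apply: eq_bigr => i _; ring.
Qed.

(** Each entry is a pairing with the indicator of a point; summing these indicators over [m] first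
    leaves only a divisibility condition. *)
Lemma stencil_fsum (R : realType) (p : nat) (a : nat -> R) (M c c' : int) :
  (0 < M)%R -> (forall i, (p < i)%N -> a i = 0) ->
  \sum_(m \in [set: int]) (a `|(c + M * m)%R|%N - a `|(c' + M * m)%R|%N) =
  stencil_pairing p a
    (fun d => (M %| d - c)%Z%:R - (M %| d - c')%Z%:R).
Proof.
(* If [x] is [c] or [c'] and [x + M * m] has absolute value at most [p], then [m], bounded by
   [M * m] in absolute value, lies in the window from [-B] to [B]; hence [r] contains every
   contributing index. *)
move=> M0 a0; pose B := (p + `|c| + `|c'|)%N.
pose r := [seq (i%:Z - B%:Z)%R | i <- iota 0 (B + B).+1].
have memr (m : int) : (`|m| <= B)%N -> m \in r.
  move=> mB; apply/mapP; exists `|(m + B%:Z)%R|%N; last by lia.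
  by rewrite mem_iota; lia.
have ur : uniq r by rewrite map_inj_uniq ?iota_uniq // => x y; lia.
have big_m (m x : int) : (`|x| <= `|c| + `|c'|)%N ->
    (`|(x + M * m)%R| <= p)%N -> m \in r.
  move=> xc xM; apply: memr.
  have : (`|m| <= `|(M * m)%R|)%N by rewrite abszM leq_pmull //; lia.
  by rewrite /B; lia.
rewrite (fsbigE r) //=; last first.
  move=> m _ mr; rewrite !a0 ?subrr // ltnNge; apply: contra mr;
    apply: big_m; lia.
under eq_bigl do rewrite in_setT.
under eq_bigr do rewrite -!(stencil_pairing_indic _ a0) -stencil_pairingB.
rewrite stencil_pairing_sum; apply: eq_stencil_pairing => d dp.
by rewrite sumrB !sum_indic_progression ?gt_eqF // => m dE;
  [apply: (big_m _ c')|apply: (big_m _ c)]; rewrite -?dE // ?leq_addr ?leq_addl.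
Qed.

(** * Unfolding along reflections and translations *)

(** The two indicators select the [l.+1] congruent to [k - d] and to [d - k] modulo [2 * N]. Up to
    sign, the class of [k - d] has exactly one representative in 1, ..., N-1, unless [k - d] is a
    multiple of [N], where [s] vanishes. *)
Lemma odd_periodic_sum (R : realType) (N : nat) (s : int -> R) (k d : int) :
  (0 < N)%N -> (forall z, s (- z) = - s z) ->
  (forall z q, s (z + 2 * N%:Z * q) = s z) ->
  \sum_(l < N.-1) ((2 * N%:Z %| d - (k - l.+1%:Z))%Z%:R
                   - (2 * N%:Z %| d - (k + l.+1%:Z))%Z%:R) * s l.+1%:Z
  = s (k - d).
Proof.
move=> N0 sN sM; set M := 2 * N%:Z in sM *.
have s0 : s 0 = 0 by have := sN 0; rewrite oppr0; lra.
(* The points [N] and [-N] differ by one period, so oddness forces a zero. *)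
have sNN : s N%:Z = 0.
  by have := sM (- N%:Z) 1; rewrite sN (_ : _ + _ = N%:Z); [lra | lia].
have [q [u [qM kdE]]] :
    exists q : nat, exists u, (q < 2 * N)%N /\ k - d = q%:Z + M * u.
  have M0 : 0 < M by lia.
  have := divz_eq (k - d) M; have := ltz_pmod (k - d) M0.
  have := modz_ge0 (k - d) (lt0r_neq0 M0).
  case: ((k - d) %% M)%Z => // q _ qM ->.
  by exists q, ((k - d) %/ M)%Z; split; [lia | ring].
have dvdM (x v : int) : (M %| x - M * v)%Z = (2 * N %| `|x|)%N.
  by rewrite (rpredBr _ (dvdz_mulr _ _)) // dvdzE abszM.
have dvd_small y : (y < 2 * N)%N -> (2 * N %| y)%N = (y == 0)%N.
  by case: y => [|y] yN; rewrite ?dvdn0 ?gtnNdvd.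
(* In terms of the remainder [q], the indicators become [l.+1 = q] and [l.+1 = 2 * N - q]: since
   [0 < l.+1 + q < 4 * N], this sum is divisible by [2 * N] only if it equals [2 * N]. *)
rewrite kdE sM; under eq_bigr => l _.
  have lN := ltn_ord l.
  rewrite (_ : d - (k - l.+1%:Z) = l.+1%:Z - q%:Z - M * u); last by lia.
  rewrite (_ : d - (k + l.+1%:Z) = - (l.+1 + q)%:Z - M * u); last by lia.
  rewrite !dvdM dvd_small; last by lia.
  rewrite (_ : (_ == 0)%N = (l.+1 == q)); last by lia.
  rewrite (_ : (2 * N %| _)%N = (l.+1 == 2 * N - q)%N); last first.
    have [lq|lq] := ltnP (l.+1 + q) (2 * N).
      by rewrite abszN dvd_small; lia.
    rewrite abszN -(subnKC lq) dvdn_addr // dvd_small; lia.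
  rewrite mulrBl.
  over.
have ind (x : nat) : (\sum_(l < N.-1) (l.+1 == x)%:R * s l.+1%:Z =
    if (0 < x < N)%N then s x%:Z else 0).
  case: x => [|x]; first by rewrite big1 // => l _; rewrite mul0r.
  under eq_bigr do rewrite eqSS mulr_natl mulrb.
  rewrite -big_mkcond (big_ord1_eq _ (fun i => s i.+1%:Z)).
  by congr (if _ then _ else _); lia.
(* For [0 < q < N] only the first sum contributes; for [q > N] only the second, and its minus sign
   is absorbed by [s (2 * N - q) = - s q]. For [q = 0] and [q = N] both sides are zero. *)
rewrite sumrB !ind; have [q0|q0] := posnP q.
  rewrite q0 /= s0; by rewrite ifF ?subr0 //; lia.
have [qN|qN|->] := ltngtP q N.
- by rewrite [X in _ - X]ifF ?subr0 //; lia.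
- rewrite ifT ?sub0r; last by lia.
  rewrite -sN -[LHS](sM _ 1); congr s; lia.
- by rewrite /= ifF ?subr0 ?sNN //; lia.
Qed.

(** * Action of a stencil matrix on the sine vectors *)

Lemma sinDpi_natmul (R : realType) (x : R) (n : nat) :
  sin (x + n%:R * (2 * pi)) = sin x.
Proof. by rewrite mulr_natl mulr_natl periodicn //; exact: sinD2pi. Qed.

Definition stencil_symbol (R : realType) (p : nat) (a : nat -> R) (t : R) : R :=
  a 0%N + 2 * \sum_(i < p) a i.+1 * cos (i.+1%:R * t).

(** After unfolding, row [k] is the convolution of the stencil with the sine; grouping [d] with [-d]
    and using sin((k-d)t) + sin((k+d)t) = 2 cos(dt) sin(kt) factors out the symbol. *)
Lemma stencil_mx_sine (R : realType) (N p j : nat) (a : nat -> R) :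
  (0 < N)%N -> (forall i, (p < i)%N -> a i = 0) ->
  stencil_mx N a *m sine_vec R N j =
  stencil_symbol p a (node_angle R N j) *: sine_vec R N j.
Proof.
move=> N0 a0; set t := node_angle R N j.
have Nt : N%:R * t = j%:R * pi.
  by rewrite /t /node_angle /mesh_size; field; rewrite pnatr_eq0 -lt0n.
pose s (z : int) := sin (z%:~R * t).
have sN z : s (- z) = - s z by rewrite /s intrN mulNr sinN.
have sM z q : s (z + 2 * N%:Z * q) = s z.
  have sMnat y (n : nat) : s (y + 2 * N%:Z * n%:Z) = s y.
    (* As [N t = j pi], a shift by [2 * N * n] adds [n * j] full turns. *)
    rewrite /s -(sinDpi_natmul (y%:~R * t) (n * j)); congr sin.
    rewrite natrM rmorphD !rmorphM /= -!pmulrn.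
    by transitivity (y%:~R * t + 2 * n%:R * (N%:R * t)); [ring|rewrite Nt; ring].
  (* For negative [q], the forward shift is applied at the translated point. *)
  case: (intP q) => [|n|n]; rewrite ?sMnat ?mulr0 ?addr0 //.
  by rewrite -[LHS](sMnat _ n.+1); congr s; ring.
apply/colP => k; rewrite !mxE.
have M0 : 0 < 2 * N%:Z by lia.
under eq_bigr do rewrite !mxE (stencil_fsum _ _ M0 a0) stencil_pairing_mulr.
rewrite stencil_pairing_sum.
rewrite (_ : stencil_pairing p a _ =
    stencil_pairing p a (fun d => s (k.+1%:Z - d))).
  rewrite /stencil_symbol /stencil_pairing subr0 mulrDl -/(s k.+1%:Z); congr (_ + _).
  rewrite mulr_sumr mulr_suml; apply: eq_bigr => i _.
  rewrite /s opprK rmorphB rmorphD /= -!pmulrn.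
  rewrite !mulrDl mulNr !sinD sinN cosN; ring.
apply: eq_stencil_pairing => d _; rewrite -(odd_periodic_sum _ _ N0 sN sM).
by apply: eq_bigr => l _; rewrite mulrC.
Qed.

(** * Linear independence of the sine vectors *)

(* Applying the product of the [T - a j], [j != i], to a vanishing combination
   kills every term except the [i]-th. *)
Lemma eigenvectors_independent (F : fieldType) (n : nat) (I : finType)
    (T : 'M[F]_n) (a x : I -> F) (v : I -> 'cV[F]_n) :
  injective a -> (forall i, v i != 0) ->
  (forall i, T *m v i = a i *: v i) ->
  \sum_i x i *: v i = 0 -> forall i, x i = 0.
Proof.
move=> a_inj v0 Tv xv0 i.
have kill (r : seq I) : \sum_i (\prod_(j <- r) (a i - a j) * x i) *: v i = 0.
  elim: r => [|j r IHr].
    by rewrite -[RHS]xv0; under eq_bigr do rewrite big_nil mul1r.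
  have := congr1 (fun w => T *m w - a j *: w) IHr.
  rewrite mulmx0 scaler0 subr0 mulmx_sumr scaler_sumr -sumrB => {2}<-.
  apply: eq_bigr => k _; rewrite big_cons -scalemxAr Tv !scalerA -scalerBl.
  by congr (_ *: _); ring.
have := kill (enum (predC1 i)); rewrite (bigD1 i) //= [X in _ + X]big1.
  move=> /eqP; rewrite addr0 scaler_eq0 (negPf (v0 i)) orbF mulf_eq0.
  case/orP => /eqP // /eqP; rewrite big_enum prodf_seq_eq0 => /hasP[j _ /andP[]].
  by rewrite !inE subr_eq0 => ji /eqP/a_inj ij; rewrite ij eqxx in ji.
move=> j ji; rewrite [X in X * _](_ : _ = 0) ?mul0r ?scale0r //.
apply/eqP; rewrite prodf_seq_eq0; apply/hasP.
by exists j; rewrite ?mem_enum //= subrr.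
Qed.

Lemma node_angle_bounds (R : realType) (N j : nat) :
  (0 < j < N)%N -> 0 < node_angle R N j < pi.
Proof.
case/andP => j0 jN; have N0 : 0 < N%:R :> R by rewrite ltr0n; lia.
rewrite /node_angle /mesh_size mul1r; apply/andP; split.
  by rewrite divr_gt0 // mulr_gt0 ?pi_gt0 ?ltr0n.
by rewrite ltr_pdivrMr // mulrC ltr_pM2l ?pi_gt0 // ltr_nat.
Qed.

(** The first entry is sin(t_j), positive because [0 < t_j < pi]. *)
Lemma sine_vec_neq0 (R : realType) (N j : nat) :
  (0 < j < N)%N -> sine_vec R N j != 0.
Proof.
move=> jN; apply/eqP => U0; have N1 : (0 < N.-1)%N by lia.
have := congr1 (fun U : 'cV__ => U (Ordinal N1) 0) U0.
rewrite !mxE mul1r => /eqP; apply/negP; rewrite gt_eqF //.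
exact/sin_gt0_pi/node_angle_bounds.
Qed.

Lemma node_angle_inj (R : realType) (N : nat) :
  (0 < N)%N -> injective (node_angle R N).
Proof.
move=> N0 i j; rewrite /node_angle /mesh_size mul1r.
move=> /mulIf ij; apply/eqP; rewrite -(eqr_nat R); apply/eqP.
apply: (mulIf (lt0r_neq0 (pi_gt0 R))); apply: ij.
by rewrite invr_eq0 pnatr_eq0 -lt0n.
Qed.

(* The sine vectors are eigenvectors of the stencil (0, 1, 0, ...), whose
   eigenvalues [2 * cos t_j] are pairwise distinct. *)
Lemma sine_vec_independent (R : realType) (N : nat) (x : 'I_N.-1 -> R) :
  \sum_j x j *: sine_vec R N j.+1 = 0 -> forall j, x j = 0.
Proof.
pose a (i : nat) : R := (i == 1)%:R.
move=> sum0; refine (eigenvectors_independent (T := stencil_mx N a)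
  (a := fun j : 'I_N.-1 => 2 * cos (node_angle R N j.+1))
  (v := fun j => sine_vec R N j.+1) _ _ _ sum0).
- move=> i j /(mulfI _) cos_ij; have iN := ltn_ord i; have jN := ltn_ord j.
  have := @cos_inj R (node_angle R N i.+1) (node_angle R N j.+1).
  have /andP[? ?] : 0 < node_angle R N i.+1 < pi by apply: node_angle_bounds; lia.
  have /andP[? ?] : 0 < node_angle R N j.+1 < pi by apply: node_angle_bounds; lia.
  rewrite !in_itv /= !ltW // => /(_ isT isT).
  rewrite cos_ij ?pnatr_eq0 // => /(_ erefl) /node_angle_inj ij.
  by apply: val_inj; apply: succn_inj; apply: ij; lia.
- by move=> j; apply: sine_vec_neq0; have := ltn_ord j; lia.
move=> j; rewrite (@stencil_mx_sine _ _ 1 _ a).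
- by rewrite /stencil_symbol big_ord1 /a /= add0r !mul1r.
- by have := ltn_ord j; lia.
- by rewrite /a => -[|[|i]].
Qed.

(** * Symbols as polynomials in the cosine *)

Lemma cos_mul2 (R : realType) (t : R) : cos (2 * t) = 2 * cos t ^+ 2 - 1.
Proof. by rewrite mulr_natl cos_mulr2n mulr_natl. Qed.

Lemma cos_mul3 (R : realType) (t : R) : cos (3 * t) = 4 * cos t ^+ 3 - 3 * cos t.
Proof.
rewrite (_ : 3 * t = t + 2 * t); last by ring.
rewrite cosD cos_mul2 [2 * t]mulr_natl sin_mulr2n -mulr_natl.
transitivity (cos t * (2 * cos t ^+ 2 - 1) - 2 * cos t * sin t ^+ 2); first by ring.
by rewrite sin2cos2; ring.
Qed.

Lemma cos_mul4 (R : realType) (t : R) : cos (4 * t) = 8 * cos t ^+ 4 - 8 * cos t ^+ 2 + 1.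
Proof. by rewrite (_ : 4 * t = 2 * (2 * t)) ?cos_mul2; ring. Qed.

Lemma sin_half_sqr (R : realType) (t : R) : sin (t / 2) ^+ 2 = (1 - cos t) / 2.
Proof.
have := cos_mul2 (t / 2); rewrite mulrC divfK ?pnatr_eq0 // => ->.
by rewrite sin2cos2; field.
Qed.

(** With x = 1 + cos t >= 0, the expression equals 4x^3 + 228x^2 + 720x + 136. *)
Lemma mass_symbol_gt0 (R : realType) (t : R) :
  0 < 1208 + 1191 * cos t + 120 * cos (2 * t) + cos (3 * t).
Proof.
rewrite cos_mul2 cos_mul3; have := cos_geN1 t; rewrite -subr_ge0 opprK => x0.
have x2 := exprn_ge0 2 x0; have x3 := exprn_ge0 3 x0; nra.
Qed.

Lemma symbol_ratio (R : realType) (N j : nat) (eta : R) :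
  (0 < N)%N ->
  let t := node_angle R N j in
  stencil_symbol 3 (mass_stencil R N) t != 0 /\
  stencil_symbol 3 (stiffness_stencil R N) t
    - eta * stencil_symbol 4 (softness_stencil R N) t
  = softiga_eigval N eta j * stencil_symbol 3 (mass_stencil R N) t.
Proof.
move=> N0 t; rewrite /softiga_eigval -/t.
have /lt0r_neq0 := mass_symbol_gt0 t.
have hN0 : mesh_size R N != 0.
  by rewrite /mesh_size mul1r invr_eq0 pnatr_eq0 -lt0n.
rewrite /stencil_symbol !big_ord_recr !big_ord0 /=.
rewrite /mass_stencil /stiffness_stencil /softness_stencil /=.
rewrite sin_half_sqr !mul1r cos_mul4 cos_mul3 cos_mul2.
(* What remains is a rational identity in [h] and [c = cos t]. *)
move: (mesh_size R N) hN0 (cos t) => h h0 c D0.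
split; last by field; rewrite D0.
(* The mass symbol is h/2520 times the denominator of the eigenvalue formula, already known to be
   nonzero. *)
rewrite [X in X != 0](_ : _ = h / 2520 * (1208 + 1191 * c + 120 * (2 * c ^+ 2 - 1) +
   (4 * c ^+ 3 - 3 * c))); last by field.
by apply: mulf_neq0 D0; apply: mulf_neq0 h0 _; rewrite invr_eq0 pnatr_eq0.
Qed.

(** * Generalized eigenpairs and eigenspaces *)

Theorem lemma4 (R : realType) (N : nat) (eta : R) (c : 'I_(N.-1) -> R)
    (hN : (2 <= N)%N) (heta : 0 <= eta) (hc : forall j, 0 < c j) :
  let A := stiffness_mx R N - eta *: softness_mx R N in
  let M := mass_mx R N in
  let lam (j : 'I_(N.-1)) : R := softiga_eigval N eta j.+1 in
  let U (j : 'I_(N.-1)) : 'cV[R]_(N.-1) := c j *: sine_vec R N j.+1 in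
  [/\ forall j, gen_eigenpair A M (lam j) (U j),
      basis_of {:'cV[R]_(N.-1)} [seq U j | j <- enum 'I_(N.-1)]
    & forall (lambda : R) (V : 'cV[R]_(N.-1)),
        gen_eigenpair A M lambda V <->
        V != 0 /\
        V \in <<[seq U j | j <- enum 'I_(N.-1) & lam j == lambda]>>%VS].
Proof.
move=> A M lam U; have N0 : (0 < N)%N by lia.
pose beta (j : 'I_N.-1) := stencil_symbol 3 (mass_stencil R N) (node_angle R N j.+1).
have beta0 j : beta j != 0 := (symbol_ratio j.+1 eta N0).1.
have MU j : M *m U j = beta j *: U j.
  rewrite -scalemxAr /M /mass_mx (@stencil_mx_sine _ _ 3) //; last first.
    by move=> i i3; rewrite /mass_stencil nth_default ?mulr0.
  by rewrite !scalerA mulrC.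
(* The symbol of [A] at t_j is [lam j] times the mass symbol, by [symbol_ratio]. *)
have AU j : A *m U j = lam j * beta j *: U j.
  rewrite -scalemxAr /A mulmxBl -scalemxAl /stiffness_mx /softness_mx.
  rewrite (@stencil_mx_sine _ _ 3) //; last first.
    by move=> i i3; rewrite /stiffness_stencil nth_default ?mulr0.
  rewrite (@stencil_mx_sine _ _ 4) //; last first.
    by move=> i i4; rewrite /softness_stencil nth_default ?mulr0.
  by rewrite scalerA -scalerBl (symbol_ratio j.+1 eta N0).2 !scalerA mulrC.
have indepU (x : 'I_N.-1 -> R) : \sum_j x j *: U j = 0 -> forall j, x j = 0.
  under eq_bigr do rewrite scalerA.
  by move=> /sine_vec_independent x0 j; have /eqP := x0 j;
    rewrite mulf_eq0 (gt_eqF (hc j)) orbF => /eqP.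
have U0 j : U j != 0.
  rewrite scaler_eq0 (gt_eqF (hc j)) sine_vec_neq0 //.
  by have := ltn_ord j; lia.
pose X := [tuple U j | j < N.-1].
have XE (j : 'I_N.-1) : X`_j = U j by rewrite -tnth_nth tnth_mktuple.
have freeX : free X.
  apply/freeP => x sum0; apply: indepU; rewrite -[RHS]sum0.
  by apply: eq_bigr => j _; rewrite XE.
have basisX : basis_of {:'cV[R]_N.-1} X.
  by rewrite basisEfree freeX subvf size_tuple dimvf /dim /= muln1 leqnn.
split => [j||lambda V].
- by split; rewrite ?AU ?MU ?scalerA.
- exact: basisX.
split=> [[V0 AMV]|[V0 VS]]; split=> //.
  have [x VE] : exists x : 'I_N.-1 -> R, V = \sum_j x j *: U j.
    exists (fun j => coord X j V); rewrite [LHS](coord_basis basisX (memvf V)).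
    by apply: eq_bigr => j _; rewrite XE.
  rewrite {}VE in AMV *.
  (* Expanding the eigenvalue equation in the basis [U] gives this vanishing combination. As
     [beta j] is nonzero, [x j] can survive only where [lam j = lambda], which places [V] in the
     required span even if several [lam j] coincide. *)
  have {}AMV : \sum_j (x j * ((lam j - lambda) * beta j)) *: U j = 0.
    move: AMV; rewrite !mulmx_sumr scaler_sumr => /eqP.
    rewrite -subr_eq0 -sumrB => /eqP sum0; rewrite -[RHS]sum0.
    apply: eq_bigr => j _.
    rewrite -scalemxAr AU -scalemxAr MU !scalerA -scalerBl.
    by congr (_ *: _); ring.
  rewrite rpred_sum // => j _; have /eqP := indepU _ AMV j.
  rewrite mulf_eq0 mulf_eq0 (negPf (beta0 j)) orbF subr_eq0.
  case/orP => [/eqP -> | lamj]; first by rewrite scale0r mem0v.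
  apply/memvZ/memv_span/map_f; rewrite mem_filter lamj; exact: mem_enum.
(* Conversely, the equation is linear in the vector, so it suffices to check it on each spanning
   [U j], where [lam j = lambda]. *)
rewrite (coord_span (X := in_tuple _) VS) !mulmx_sumr scaler_sumr.
apply: eq_bigr => i _; rewrite -!scalemxAr scalerA mulrC -scalerA.
congr (_ *: _); have /mapP[j] := mem_nth 0 (ltn_ord i).
by rewrite mem_filter => /andP[/eqP lamj _] ->; rewrite AU MU scalerA lamj.
Qed.
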